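(* Let $\Sigma=(f,g)$, $\dot\xi=f(\xi)+g(\xi)u$, $u\in\mathbb{R}$, be a control-affine system on a $3$-dimensional state-space manifold with scalar control satisfying, at every point, $f\wedge g\wedge[g,f]\neq0$ and $g\wedge[g,f]\wedge[g,[g,f]]\neq0$, and let $(k_1,k_2,k_3)$ and $(\lambda_1,\lambda_2,\lambda_3)$ be its structure functions, uniquely defined by $$[f,[f,g]]=k_1g+k_2[g,f]+k_3[g,[g,f]],\qquad [g,[g,f]]=\lambda_1f+\lambda_2g+\lambda_3[g,f].$$ Then the invariants $(\varepsilon,\kappa,\nu)$ of $\Sigma$ are given by $$\varepsilon=\mathrm{sgn}(\lambda_1),$$ $$\kappa=k_1+\tfrac12L_f\big(k_2-L_g(k_3)\big)+\tfrac14\big(k_2-L_g(k_3)\big)^2+L_{[g,f]}(k_3)+\tfrac12k_3\,L_g\big(k_2-L_g(k_3)\big),$$ $$\nu=|\lambda_1|^{-1/2}\Big(\lambda_3-\tfrac12L_g(\ln|\lambda_1|)\Big).$$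
   Context: All objects are $C^\infty$-smooth; $L_v(\lambda)$ denotes the Lie derivative of the function $\lambda$ along $v$, and $L_{[f,g]}=L_fL_g-L_gL_f$. The second regularity assumption, $g\wedge[g,f]\wedge[g,[g,f]]\neq0$, implies $\lambda_1\neq0$ everywhere. A pair $(f,g)$ is called canonical if $k_3\equiv0$ and $\lambda_1\equiv\pm1$. Under feedback transformations $f\mapsto f+g\alpha$, $g\mapsto g\beta$ ($\alpha$, $\beta\ne0$ smooth), every control-affine system $\Sigma=(f,g)$ on a $3$-dimensional manifold with scalar control satisfying, at every point, $f\wedge g\wedge[g,f]\neq0$ and $g\wedge[g,f]\wedge[g,[g,f]]\neq0$, with structure functions $k_i,\lambda_i$ defined by $[f,[f,g]]=k_1g+k_2[g,f]+k_3[g,[g,f]]$ and $[g,[g,f]]=\lambda_1f+\lambda_2g+\lambda_3[g,f]$, can be brought to the canonical pair $f_c=f+k_3g$, $g_c=|\lambda_1|^{-1/2}g$, which is unique up to $g_c\mapsto-g_c$. For the canonical pair $$[f_c,[f_c,g_c]]=\kappa g_c,\qquad [g_c,[g_c,f_c]]=\varepsilon f_c+\mu g_c+\nu[g_c,f_c],\qquad \varepsilon=\pm1,$$ and the invariants of $\Sigma$ are the triple $(\varepsilon,\kappa,\nu)$ so defined ($\nu$ being defined up to the sign change induced by $g_c\mapsto-g_c$; the formula corresponds to $g_c=|\lambda_1|^{-1/2}g$). *)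

(* Defs.v *)
From HB Require Import structures.
From mathcomp Require Import all_boot all_order all_algebra.
From mathcomp Require Import all_classical all_reals all_analysis.
From mathcomp Require Import ring.

Set Implicit Arguments.
Unset Strict Implicit.
Unset Printing Implicit Defensive.
Import Order.TTheory GRing.Theory Num.Theory.
Import numFieldNormedType.Exports.
Local Open Scope classical_set_scope.
Local Open Scope ring_scope.

Section smooth_Rn.
Context {R : realType} {n : nat}.
Implicit Types (U : set 'rV[R]_n) (u v : 'rV[R]_n -> R).

(* On an open set U: all iterated partial derivatives of order <= k exist and
   are continuous at every point of U. *)
Fixpoint Ck_on (k : nat) U u : Prop :=
  (forall x, U x -> {for x, continuous u}) /\
  match k with
  | 0 => True
  | k'.+1 => forall i : 'I_n,
      (forall x, U x -> derivable u x (delta_mx 0 i)) /\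
      Ck_on k' U (fun x => 'D_(delta_mx 0 i) u x)
  end.

Definition smooth_on U u := forall k, Ck_on k U u.

Lemma Ck_on_eq k U u v : open U -> (forall x, U x -> u x = v x) ->
  Ck_on k U u -> Ck_on k U v.
Proof.
move=> oU; elim: k u v => [|k IH] u v uv uk.
all: have nuv x : U x -> {near x, u =1 v} by
  move=> Ux; apply: filterS (open_nbhs_nbhs (conj oU Ux)) => y /uv.
all: have cv x : U x -> {for x, continuous v} by
  move=> Ux; rewrite /prop_for /continuous_at -uv//;
  apply: (cvg_trans _ (uk.1 _ Ux)); exact: (@near_eq_cvg _ _ (nbhs x) _ _ _ (nuv x Ux)).
  by [].
split=> // i; have [di ci] := uk.2 i; split=> [x Ux|].
  exact: near_eq_derivable (nuv x Ux) (di x Ux).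
by apply: IH ci => x Ux; apply: near_eq_derive; exact: nuv.
Qed.

Lemma Ck_onW k U u : Ck_on k.+1 U u -> Ck_on k U u.
Proof.
elim: k u => [|k IH] u; first by case.
move=> [cu du]; split=> // i; have [di ci] := du i; split=> //; exact: IH.
Qed.

Lemma Ck_on_cst k U (c : R) : open U -> Ck_on k U (cst c).
Proof.
move=> oU; elim: k c => [|k IH] c /=.
  by split=> // x _; exact: cst_continuous.
split=> [x _|i]; first exact: cst_continuous.
split=> [x _|]; first exact: derivable_cst.
by apply: Ck_on_eq (IH 0) => // x _; rewrite derive_cst.
Qed.

Lemma Ck_onD k U u v : open U -> Ck_on k U u -> Ck_on k U v ->
  Ck_on k U (u + v).
Proof.
move=> oU; elim: k u v => [|k IH] u v /= [cu du] [cv dv].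
  by split=> // x Ux; exact: (cvgD (cu x Ux) (cv x Ux)).
split=> [x Ux|i]; first by exact: (cvgD (cu x Ux) (cv x Ux)).
have [[du1 du2] [dv1 dv2]] := (du i, dv i).
split=> [x Ux|]; first by apply: derivableD; [exact: du1|exact: dv1].
apply: Ck_on_eq (IH _ _ du2 dv2) => // x Ux.
by rewrite deriveD//; [exact: du1|exact: dv1].
Qed.

Lemma Ck_onM k U u v : open U -> Ck_on k U u -> Ck_on k U v ->
  Ck_on k U (u * v).
Proof.
move=> oU; elim: k u v => [|k IH] u v /= uk vk.
  case: uk vk => [cu _] [cv _].
  by split=> // x Ux; exact: (cvgM (cu x Ux) (cv x Ux)).
have [[cu du] [cv dv]] := (uk, vk).
split=> [x Ux|i]; first by exact: (cvgM (cu x Ux) (cv x Ux)).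
have [[du1 du2] [dv1 dv2]] := (du i, dv i).
split=> [x Ux|]; first by apply: derivableM; [exact: du1|exact: dv1].
have := Ck_onD oU (IH _ _ (Ck_onW uk) dv2) (IH _ _ (Ck_onW vk) du2).
apply: Ck_on_eq => // x Ux.
by rewrite deriveM//; [exact: du1|exact: dv1].
Qed.

End smooth_Rn.

Record chart (R : realType) (n : nat) (T : topologicalType) := Chart {
  cdom : set T;
  cmap : T -> 'rV[R]_n;
  cinv : 'rV[R]_n -> T;
  cdom_open : open cdom;
  cimg_open : open (cmap @` cdom);
  cmapK : forall p, cdom p -> cinv (cmap p) = p;
  cmap_cont : forall p, cdom p -> {for p, continuous cmap};
  cinv_cont : forall x, (cmap @` cdom) x -> {for x, continuous cinv} }.

(* Smooth n-dimensional manifolds without boundary; connectedness is not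
   required. *)
Record manifold (R : realType) (n : nat) := Manifold {
  mcarrier :> topologicalType;
  atlas : set (chart R n mcarrier);
  atlas_cover : forall p : mcarrier, exists2 c, atlas c & cdom c p;
  atlas_compat : forall c d, atlas c -> atlas d -> forall i : 'I_n,
    smooth_on (cmap c @` (cdom c `&` cdom d))
              (fun x => cmap d (cinv c x) 0 i);
  manifold_hausdorff : hausdorff_space mcarrier;
  manifold_second_countable : @second_countable mcarrier }.

Section smooth_functions.
Context {R : realType} {n : nat}.
Variable M : manifold R n.

Definition smooth (a : M -> R) : Prop :=
  forall c, atlas c -> smooth_on (cmap c @` cdom c) (a \o cinv c).

Definition smooth_pred : {pred (M -> R)} := mem [set a | smooth a].
Definition smooth_key : pred_key smooth_pred. Proof. exact. Qed.
Canonical smooth_keyed := KeyedPred smooth_key.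

Lemma smooth_cst (c : R) : smooth (cst c).
Proof. by move=> d _ k; apply: Ck_on_cst; exact: cimg_open. Qed.

Lemma smoothD (a b : M -> R) : smooth a -> smooth b -> smooth (a + b).
Proof.
by move=> sa sb d ad k; apply: Ck_onD; [exact: cimg_open|exact: sa|exact: sb].
Qed.

Lemma smoothM (a b : M -> R) : smooth a -> smooth b -> smooth (a * b).
Proof.
by move=> sa sb d ad k; apply: Ck_onM; [exact: cimg_open|exact: sa|exact: sb].
Qed.

Lemma smooth_subring_closed : subring_closed smooth_pred.
Proof.
split=> [|a b|a b]; rewrite !inE /=; first exact: (smooth_cst 1).
- move=> sa sb; apply: smoothD => //; rewrite -mulN1r; apply: smoothM => //.
  exact: (smooth_cst (-1)).
- exact: smoothM.
Qed.
HB.instance Definition _ :=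
  GRing.isSubringClosed.Build _ smooth_pred smooth_subring_closed.

Record Cinf := MkCinf {
  cinf_fun :> M -> R;
  cinf_subproof : cinf_fun \in smooth_pred }.

HB.instance Definition _ := [isSub for cinf_fun].
HB.instance Definition _ := [Choice of Cinf by <:].
HB.instance Definition _ := GRing.SubChoice_isSubComPzRing.Build _ _ Cinf
  smooth_subring_closed.

Lemma smooth_submod_closed : subsemimod_closed smooth_pred.
Proof.
split=> [|c a]; first by split; [exact: rpred0|exact: rpredD].
rewrite !inE /=; exact: (smoothM (smooth_cst c)).
Qed.
HB.instance Definition _ :=
  GRing.SubZmodule_isSubLmodule.Build _ _ _ Cinf smooth_submod_closed.

Lemma cinfP (a b : Cinf) : (forall p, a p = b p) -> a = b.
Proof. by move=> ab; apply/val_inj/funext. Qed.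

Lemma cinfE p :
  ((0 : Cinf) p = 0) * ((1 : Cinf) p = 1) *
  (forall a b : Cinf, (a + b) p = a p + b p) *
  (forall a b : Cinf, (a * b) p = a p * b p) *
  (forall a : Cinf, (- a) p = - a p) *
  (forall (c : R) (a : Cinf), (c *: a) p = c * a p).
Proof. by []. Qed.

End smooth_functions.

Section vector_fields.
Context {R : realType} {n : nat} {M : manifold R n}.

(* Smooth vector fields are the R-linear derivations of the algebra of smooth
   functions; [X a] is the Lie derivative of the function [a] along [X], and
   the tangent vector of X at p is the point derivation [fun a => X a p]. *)
Record vfield := VField {
  lie_der :> Cinf M -> Cinf M;
  lie_der_linear : forall (c : R) a b,
    lie_der (c *: a + b) = c *: lie_der a + lie_der b;
  lie_der_leibniz : forall a b,
    lie_der (a * b) = lie_der a * b + a * lie_der b }.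

Implicit Types (X Y Z : vfield) (a b : Cinf M).

Lemma vfieldP X Y : (forall a, X a = Y a) -> X = Y.
Proof.
case: X Y => [X X1 X2] [Y Y1 Y2] /= /funext XY; subst Y.
by rewrite (Prop_irrelevance X1 Y1) (Prop_irrelevance X2 Y2).
Qed.

HB.instance Definition _ := gen_eqMixin vfield.
HB.instance Definition _ := gen_choiceMixin vfield.

Lemma lie_derD X a b : X (a + b) = X a + X b.
Proof. by have := lie_der_linear X 1 a b; rewrite !scale1r. Qed.

Lemma lie_der0 X : X 0 = 0.
Proof. by apply: (addrI (X 0)); rewrite -lie_derD !addr0. Qed.

Lemma lie_derZ X (c : R) a : X (c *: a) = c *: X a.
Proof. by have := lie_der_linear X c a 0; rewrite lie_der0 !addr0. Qed.

Lemma lie_derN X a : X (- a) = - X a.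
Proof. by rewrite -scaleN1r lie_derZ scaleN1r. Qed.

Lemma lie_derB X a b : X (a - b) = X a - X b.
Proof. by rewrite lie_derD lie_derN. Qed.

Lemma vf_zero_linear (c : R) a b :
  let L a := (0 : Cinf M) in L (c *: a + b) = c *: L a + L b.
Proof. by move=> L; apply: cinfP => p; rewrite /L !cinfE; ring. Qed.
Lemma vf_zero_leibniz a b :
  let L a := (0 : Cinf M) in L (a * b) = L a * b + a * L b.
Proof. by move=> L; apply: cinfP => p; rewrite /L !cinfE; ring. Qed.
Definition vf_zero := VField (@vf_zero_linear) (@vf_zero_leibniz).

Lemma vf_opp_linear X (c : R) a b :
  let L a := - X a in L (c *: a + b) = c *: L a + L b.
Proof. by move=> L; apply: cinfP => p; rewrite /L lie_der_linear !cinfE; ring. Qed.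
Lemma vf_opp_leibniz X a b :
  let L a := - X a in L (a * b) = L a * b + a * L b.
Proof. by move=> L; apply: cinfP => p; rewrite /L lie_der_leibniz !cinfE; ring. Qed.
Definition vf_opp X := VField (@vf_opp_linear X) (@vf_opp_leibniz X).

Lemma vf_add_linear X Y (c : R) a b :
  let L a := X a + Y a in L (c *: a + b) = c *: L a + L b.
Proof. by move=> L; apply: cinfP => p; rewrite /L !lie_der_linear !cinfE; ring. Qed.
Lemma vf_add_leibniz X Y a b :
  let L a := X a + Y a in L (a * b) = L a * b + a * L b.
Proof. by move=> L; apply: cinfP => p; rewrite /L !lie_der_leibniz !cinfE; ring. Qed.
Definition vf_add X Y := VField (@vf_add_linear X Y) (@vf_add_leibniz X Y).

Lemma vf_scale_linear (h : Cinf M) X (c : R) a b :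
  let L a := h * X a in L (c *: a + b) = c *: L a + L b.
Proof. by move=> L; apply: cinfP => p; rewrite /L lie_der_linear !cinfE; ring. Qed.
Lemma vf_scale_leibniz (h : Cinf M) X a b :
  let L a := h * X a in L (a * b) = L a * b + a * L b.
Proof. by move=> L; apply: cinfP => p; rewrite /L lie_der_leibniz !cinfE; ring. Qed.
Definition vf_scale (h : Cinf M) X := VField (@vf_scale_linear h X) (@vf_scale_leibniz h X).

Lemma lie_linear X Y (c : R) a b :
  let L a := X (Y a) - Y (X a) in L (c *: a + b) = c *: L a + L b.
Proof. by move=> L; apply: cinfP => p; rewrite /L !lie_der_linear !cinfE; ring. Qed.
Lemma lie_leibniz X Y a b :
  let L a := X (Y a) - Y (X a) in L (a * b) = L a * b + a * L b.
Proof. by move=> L; apply: cinfP => p; rewrite /L !lie_der_leibniz !lie_derD !lie_der_leibniz !cinfE; ring. Qed.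
Definition lie X Y := VField (@lie_linear X Y) (@lie_leibniz X Y).

Lemma vf_addA : associative vf_add.
Proof. by move=> X Y Z; apply: vfieldP => a; exact: addrA. Qed.
Lemma vf_addC : commutative vf_add.
Proof. by move=> X Y; apply: vfieldP => a; exact: addrC. Qed.
Lemma vf_add0 : left_id vf_zero vf_add.
Proof. by move=> X; apply: vfieldP => a; exact: add0r. Qed.
Lemma vf_addN : left_inverse vf_zero vf_opp vf_add.
Proof. by move=> X; apply: vfieldP => a; exact: addNr. Qed.
HB.instance Definition _ :=
  GRing.isZmodule.Build vfield vf_addA vf_addC vf_add0 vf_addN.

Lemma vf_scaleA h k X : vf_scale h (vf_scale k X) = vf_scale (h * k) X.
Proof. by apply: vfieldP => a; exact: mulrA. Qed.
Lemma vf_scale1 : left_id 1 vf_scale.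
Proof. by move=> X; apply: vfieldP => a; exact: mul1r. Qed.
Lemma vf_scaleDr : right_distributive vf_scale +%R.
Proof. by move=> h X Y; apply: vfieldP => a; exact: mulrDr. Qed.
Lemma vf_scaleDl X : {morph vf_scale^~ X : h k / h + k}.
Proof. by move=> h k; apply: vfieldP => a; exact: mulrDl. Qed.
HB.instance Definition _ := GRing.Zmodule_isLmodule.Build (Cinf M) vfield
  vf_scaleA vf_scale1 vf_scaleDr vf_scaleDl.

End vector_fields.

Arguments vfield {R n} M.

Section control_affine.
Context {R : realType} {n : nat} {M : manifold R n}.
Implicit Types (f g X Y Z : vfield M) (p : M).

(* The trivector X_p /\ Y_p /\ Z_p as an alternating form on covectors, each
   covector being the differential at p of a smooth function. *)
Definition wedge3 X Y Z p : ('I_3 -> Cinf M) -> R := fun a =>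
  \det (\matrix_(i < 3, j < 3) (tnth [tuple X; Y; Z] i) (a j) p).

Definition structure_functions f g (k1 k2 k3 l1 l2 l3 : Cinf M) : Prop :=
  lie f (lie f g) = k1 *: g + k2 *: lie g f + k3 *: lie g (lie g f) /\
  lie g (lie g f) = l1 *: f + l2 *: g + l3 *: lie g f.

Definition feedback_equiv f g f' g' : Prop :=
  exists a b : Cinf M,
    [/\ forall p, b p != 0, f' = f + a *: g & g' = b *: g].

(* A smooth function with values in {1, -1} is locally constant, hence constant
   on every connected component of M. *)
Definition unit_sign (s : Cinf M) : Prop := forall p, s p = 1 \/ s p = -1.

Definition canonical f g : Prop :=
  exists k1 k2 k3 l1 l2 l3 : Cinf M,
    [/\ structure_functions f g k1 k2 k3 l1 l2 l3, k3 = 0 & unit_sign l1].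

(* (e, kappa, nu) are the invariants of the system (f, g), computed from the
   canonical pair (fc, gc) of its feedback orbit. *)
Definition invariants f g fc gc (e kappa nu : Cinf M) : Prop :=
  [/\ feedback_equiv f g fc gc, canonical fc gc,
      lie fc (lie fc gc) = kappa *: gc, unit_sign e &
      exists mu : Cinf M,
        lie gc (lie gc fc) = e *: fc + mu *: gc + nu *: lie gc fc].

End control_affine.

(* Main.v *)
(* Write h = [g, f]. For fc = f + a g and gc = b g, expand the brackets
   [gc, [gc, fc]] and [fc, [fc, gc]] in the frame (f, g, h). The f-components
   are b^2 l1 and b (k3 - a) l1, so a canonical pair must have a = k3 and
   b = +-|l1|^{-1/2}. The f-component of the Jacobi identity
   [f, [g, h]] = [g, [f, h]] reads fc(l1) = -(k2 + g(k3)) l1; it gives fc(b) and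
   thereby kills the h-component of [fc, [fc, gc]], and the remaining components
   are the stated kappa and nu.
   Vector fields being abstract derivations of the algebra of smooth functions,
   the chain rule X(exp v) = exp(v) X(v) has to be derived from the Leibniz rule:
   by Hadamard's factorisation exp v = 1 + v E(v), where E is an entire function,
   both sides agree at the zeros of v, and translating v covers every point. *)
Require Import Defs.
From mathcomp Require Import all_boot all_order all_algebra.
From mathcomp Require Import all_classical all_reals all_analysis.
From mathcomp Require Import ring lra.
Import Order.TTheory GRing.Theory Num.Theory.
Import numFieldNormedType.Exports.
Local Open Scope classical_set_scope.
Local Open Scope ring_scope.

(** * Composition of smooth functions with functions of one real variable *)

(** Caratheodory's factorisation [phi y - phi (u x) = s y * (y - u x)] splits the difference
    quotient without dividing by an increment of [u], which may vanish. *)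
Lemma is_derive_comp_line {R : realType} (V : normedModType R) (phi : R -> R)
    (u : V -> R) x v d d' :
  {for x, continuous u} -> is_derive (u x) 1 phi d -> is_derive x v u d' ->
  is_derive x v (phi \o u) (d * d').
Proof.
move=> cu /is_derive1_caratheodory[s [sE cs sx]] [du uv].
have sux : (s \o u) x @[x --> x] --> d by rewrite -sx; exact: (cvg_comp _ _ cu cs).
have line : h *: v + x @[h --> 0^'] --> x.
  rewrite -[X in _ --> X]add0r -(scale0r v).
  by apply: cvgD; [apply: cvgZr_tmp; exact: cvg_within|exact: cvg_cst].
have H : h^-1 *: (((phi \o u) \o shift x) (h *: v) - (phi \o u) x) @[h --> 0^']
    --> d * d'.
  rewrite [X in X @ _](_ : _ = fun h => (s \o u) (h *: v + x) *
      (h^-1 *: ((u \o shift x) (h *: v) - u x))); last first.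
    by apply/funext => h /=; rewrite sE -[RHS]scalerAr.
  apply: cvgM; first exact: (cvg_comp _ _ line sux).
  by rewrite -uv; exact: du.
by split; [apply/cvg_ex; exists (d * d')|exact: cvg_lim H].
Qed.

(* A class of functions closed under derivation replaces explicit formulas for the
   iterated derivatives of phi. *)
Lemma Ck_on_comp {R : realType} {n : nat} (S : set (R -> R)) (D : set R)
    k (U : set 'rV[R]_n) u phi :
  (forall psi, S psi -> exists2 psi', S psi' &
     forall t, D t -> is_derive t 1 psi (psi' t)) ->
  open U -> (forall x, U x -> D (u x)) -> S phi ->
  Ck_on k U u -> Ck_on k U (phi \o u).
Proof.
move=> SD oU UD; elim: k phi => [|k IH] phi Sphi uk.
all: have [psi Spsi dphi] := SD _ Sphi.
all: have cphi x : U x -> {for x, continuous (phi \o u)} by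
  move=> Ux; apply: continuous_comp; [exact: uk.1|];
  have [+ _] := dphi _ (UD _ Ux);
  move/derivable1_diffP/differentiable_continuous.
  by [].
split=> // i; have [du cdu] := uk.2 i.
have dcomp x : U x -> is_derive x (delta_mx 0 i) (phi \o u)
    (psi (u x) * 'D_(delta_mx 0 i) u x).
  move=> Ux; apply: is_derive_comp_line; [exact: uk.1|exact/dphi/UD|].
  by split=> //; exact: du.
split=> [x Ux|]; first by have [] := dcomp x Ux.
have := Ck_onM oU (IH _ Spsi (Ck_onW uk)) cdu.
by apply: Ck_on_eq => // x Ux; have [_ ->] := dcomp x Ux.
Qed.

Lemma smooth_comp {R : realType} {n : nat} {M : manifold R n}
    (S : set (R -> R)) (D : set R) (a : Cinf M) phi :
  (forall psi, S psi -> exists2 psi', S psi' &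
     forall t, D t -> is_derive t 1 psi (psi' t)) ->
  S phi -> (forall p, D (a p)) -> exists b : Cinf M, forall p, b p = phi (a p).
Proof.
move=> SD Sphi Da; have sb : (phi \o a) \in @smooth_pred R n M.
  rewrite inE => c ac k; apply: (@Ck_on_comp _ _ S D k _ (a \o cinv c)) => //.
  - exact: cimg_open.
  - by move=> x _; exact: Da.
  - by have := cinf_subproof a; rewrite inE => sa; exact: (sa c ac k).
by exists (MkCinf sb).
Qed.

Lemma smooth_powR {R : realType} {n : nat} {M : manifold R n} (a : Cinf M) r :
  (forall p, 0 < a p) -> exists b : Cinf M, forall p, b p = a p `^ r.
Proof.
(* The factor [c] absorbs the exponents produced by differentiation, which keeps the class
   stable. *)
pose S := [set phi : R -> R | exists c s, phi = fun t => c * t `^ s].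
move=> a0; apply: (@smooth_comp _ _ _ S [set t | 0 < t] a (@powR R ^~ r)) => //.
  move=> _ [c [s ->]]; exists (fun t => c * s * t `^ (s - 1)).
    by exists (c * s), (s - 1).
  move=> t t0; have := is_derive1_powR s t0 => ?.
  by apply: is_derive_eq; rewrite /= ?scaler0 ?addr0 /GRing.scale/=; ring.
by exists 1, r; apply/funext => t; rewrite mul1r.
Qed.

Lemma smooth_ln {R : realType} {n : nat} {M : manifold R n} (a : Cinf M) :
  (forall p, 0 < a p) -> exists b : Cinf M, forall p, b p = ln (a p).
Proof.
(* Differentiating the logarithm leads back to the powers. *)
pose S := [set phi : R -> R | phi = @ln R \/ exists c s, phi = fun t => c * t `^ s].
move=> a0; apply: (@smooth_comp _ _ _ S [set t | 0 < t] a (@ln R)) => //;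
  last by left.
move=> _ [->|[c [s ->]]].
  exists (fun t => 1 * t `^ (-1)); first by right; exists 1, (-1).
  move=> t t0; have := is_derive1_ln t0 => ?.
  by rewrite mul1r powR_inv1// ltW.
exists (fun t => c * s * t `^ (s - 1)); first by right; exists (c * s), (s - 1).
move=> t t0; have := is_derive1_powR s t0 => ?.
by apply: is_derive_eq; rewrite /= ?scaler0 ?addr0 /GRing.scale/=; ring.
Qed.

(** * Entire power series and the factorisation of the exponential *)

(* Power series with such coefficients are entire, and the class is stable under
   derivation. *)
Definition exp_dominated {R : realType} (c : R^nat) :=
  forall n, `|c n| <= n`!%:R^-1.

Lemma exp_dominated_diffs {R : realType} (c : R^nat) :
  exp_dominated c -> exp_dominated (pseries_diffs c).
Proof.
move=> cb n; rewrite /pseries_diffs normrM normr_nat.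
have -> : (n`!%:R : R)^-1 = n.+1%:R * (n.+1)`!%:R^-1.
  by rewrite factS natrM invfM mulVKf.
by rewrite ler_wpM2l.
Qed.

Lemma exp_dominated_cvg {R : realType} {c : R^nat} x :
  exp_dominated c -> cvgn (pseries c x).
Proof.
move=> cb; apply: normed_cvg; apply: series_le_cvg (is_cvg_series_exp_coeff `|x|).
- by move=> n /=.
- by move=> n; rewrite exp_coeff_ge0.
- by move=> n /=; rewrite /exp_coeff/= normrM normrX mulrC ler_wpM2l ?exprn_ge0.
Qed.

Lemma exp_dominated_derive {R : realType} (c : R^nat) (x : R) : exp_dominated c ->
  is_derive x 1 (fun t => limn (pseries c t)) (limn (pseries (pseries_diffs c) x)).
Proof.
(* The number [|x| + 1] serves as a point of convergence of modulus greater than that of [x]. *)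
move=> cb; apply: (@pseries_snd_diffs _ _ (`|x| + 1)).
- exact: exp_dominated_cvg.
- exact/exp_dominated_cvg/exp_dominated_diffs.
- exact/exp_dominated_cvg/exp_dominated_diffs/exp_dominated_diffs.
- by rewrite [ltRHS]ger0_norm// ltrDl.
Qed.

(** These are the Taylor coefficients at 0 of the entire function [(expR x - 1) / x]. *)
Lemma exp_dominated_inv_factS {R : realType} :
  exp_dominated (fun n => n.+1`!%:R^-1 : R).
Proof.
move=> n; rewrite ger0_norm// lef_pV2 ?posrE ?ltr0n ?fact_gt0//.
by rewrite ler_nat factS leq_pmull.
Qed.

(** The constant term of the exponential series is split off and [x] is factored out of the rest. *)
Lemma expR_hadamard {R : realType} (x : R) :
  expR x = 1 + x * limn (pseries (fun n => n.+1`!%:R^-1) x).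
Proof.
have /cvg_ex[l El] := exp_dominated_cvg x exp_dominated_inv_factS.
rewrite (cvg_lim _ El)//.
apply: cvg_lim => //; rewrite -cvg_shiftS.
rewrite [X in X @ _](_ : _ = fun n =>
    1 + x * pseries (fun n => n.+1`!%:R^-1) x n); last first.
  apply/funext => n; rewrite /pseries /series /= big_nat_recl//=.
  rewrite /exp_coeff /= expr0 fact0 divr1 mulr_sumr; congr (_ + _).
  by apply: eq_bigr => i _; rewrite exprS; ring.
by apply: cvgD; [exact: cvg_cst|apply: cvgM => //; exact: cvg_cst].
Qed.

(** * Calculus of Lie derivatives and brackets *)

Section lie_calculus.
Context {R : realType} {n : nat} {M : manifold R n}.
Implicit Types (X Y Z : vfield M) (a b : Cinf M).

Lemma vfD X Y a : (X + Y) a = X a + Y a. Proof. by []. Qed.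
Lemma vfN X a : (- X) a = - X a. Proof. by []. Qed.
Lemma vfZ b X a : (b *: X) a = b * X a. Proof. by []. Qed.

Lemma lieE X Y a : lie X Y a = X (Y a) - Y (X a). Proof. by []. Qed.

Lemma lie_antisym X Y : lie Y X = - lie X Y.
Proof. by apply: vfieldP => a; rewrite vfN /= opprB. Qed.

Lemma lieDr X Y Z : lie X (Y + Z) = lie X Y + lie X Z.
Proof.
apply: vfieldP => a; apply: cinfP => p.
by rewrite !(vfD, lieE) lie_derD !cinfE; ring.
Qed.

Lemma lieZr X a Y : lie X (a *: Y) = X a *: Y + a *: lie X Y.
Proof.
apply: vfieldP => b; apply: cinfP => p.
by rewrite !(vfD, vfZ, lieE) lie_der_leibniz !cinfE; ring.
Qed.

Lemma lieDl X Y Z : lie (X + Y) Z = lie X Z + lie Y Z.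
Proof. by rewrite !(lie_antisym Z) lieDr opprD. Qed.

Lemma lieZl a X Y : lie (a *: X) Y = - (Y a *: X) + a *: lie X Y.
Proof. by rewrite !(lie_antisym Y) lieZr opprD scalerN. Qed.

Lemma liexx X : lie X X = 0.
Proof. by apply: vfieldP => a; rewrite /= subrr. Qed.

(** By the Jacobi identity the two sides differ by [[[X, Y], [Y, X]]], a bracket of opposite fields,
    hence zero. *)
Lemma lie_jacobi X Y : lie X (lie Y (lie Y X)) = lie Y (lie X (lie Y X)).
Proof.
apply: vfieldP => a; rewrite !(lieE, lie_derB).
by apply: cinfP => p; rewrite !cinfE; ring.
Qed.

Lemma lie_der1 X : X 1 = 0.
Proof.
have := lie_der_leibniz X 1 1; rewrite !mulr1 mul1r => /eqP.
by rewrite -subr_eq0 opprD addrA subrr sub0r oppr_eq0 => /eqP.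
Qed.

(** Differentiating [s * s = 1] gives [2 s X(s) = 0], and [s] never vanishes. *)
Lemma lie_der_unit_sign X s : unit_sign s -> X s = 0.
Proof.
move=> us; have ss : s * s = 1.
  by apply: cinfP => p; rewrite !cinfE; case: (us p) => ->; ring.
have := lie_der_leibniz X s s; rewrite ss lie_der1 => H.
apply: cinfP => p; have := congr1 (fun a : Cinf M => a p) H.
by rewrite !cinfE; case: (us p) => ->; lra.
Qed.
End lie_calculus.

(** * Linear independence and comparison of components *)

(** A nonzero trivector is nonzero on some triple of differentials, and the row of coefficients lies
    in the left kernel of the resulting invertible matrix. *)
Lemma wedge3_free {R : realType} {n : nat} {M : manifold R n}
    {X Y Z : vfield M} {p} {x y z : R} :
  wedge3 X Y Z p != 0 ->
  (forall t, x * X t p + y * Y t p + z * Z t p = 0) ->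
  [/\ x = 0, y = 0 & z = 0].
Proof.
move=> w e.
have [t wt] : exists t, wedge3 X Y Z p t != 0.
  apply: contrapT => H; case/eqP: w; apply/funext => t.
  by apply/eqP; apply: contrapT => /negP ne; apply: H; exists t.
pose A : 'M[R]_3 := \matrix_(i, j) (tnth [tuple X; Y; Z] i) (t j) p.
pose u : 'rV[R]_3 := \row_i tnth [tuple x; y; z] i.
have uA : u *m A = 0.
  apply/rowP => j; rewrite !mxE !big_ord_recl big_ord0 !mxE !(tnth_nth 0) /=.
  by rewrite addr0 addrA e.
have u0 : u = 0.
  have Au : A \in unitmx by rewrite unitmxE unitfE.
  by rewrite -[u](mulmxK Au) uA mul0mx.
by split; [have := congr1 (fun v : 'rV[R]_3 => v 0 0) u0|
  have := congr1 (fun v : 'rV[R]_3 => v 0 1) u0|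
  have := congr1 (fun v : 'rV[R]_3 => v 0 (inord 2)) u0];
  rewrite !mxE (tnth_nth 0) /= ?inordK.
Qed.

Lemma frame_free {R : realType} {n : nat} {M : manifold R n}
    {X Y Z : vfield M} {a b c a' b' c' : Cinf M} :
  (forall p, wedge3 X Y Z p != 0) ->
  a *: X + b *: Y + c *: Z = a' *: X + b' *: Y + c' *: Z ->
  [/\ a = a', b = b' & c = c'].
Proof.
move=> w E.
suff H p : [/\ a p - a' p = 0, b p - b' p = 0 & c p - c' p = 0].
  by split; apply: cinfP => p; case: (H p) => *; apply: subr0_eq.
apply: wedge3_free (w p) _ => t.
have := congr1 (fun V : vfield M => V t p) E.
rewrite !(vfD, vfZ, cinfE) => /eqP; rewrite -subr_eq0 => /eqP Et.
by rewrite -[RHS]Et; ring.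
Qed.

Ltac vf_ring := apply: vfieldP => ?; apply: cinfP => ?;
  rewrite !(vfD, vfN, vfZ, cinfE); ring.

(** * Bracket expansions in the frame [(f, g, [g, f])] *)

Section frame.
Context {R : realType} {n : nat} {M : manifold R n}.
Implicit Types (f g : vfield M) (a b : Cinf M).

(** Together with the second structure equation this completes the bracket table of the frame. *)
Lemma lie_drift_bracket {f g} {k1 k2 k3 l1 l2 l3 : Cinf M} :
  structure_functions f g k1 k2 k3 l1 l2 l3 ->
  lie f (lie g f) = (- (k3 * l1)) *: f + (- (k1 + k3 * l2)) *: g
    + (- (k2 + k3 * l3)) *: lie g f.
Proof.
move=> [Efg Egh]; have -> : lie f (lie g f) = - lie f (lie f g).
  by rewrite (lie_antisym g f) -[- lie g f]scaleN1r lieZr lie_derN lie_der1;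
     vf_ring.
by rewrite Efg Egh; vf_ring.
Qed.

Lemma structure_jacobi {f g} {k1 k2 k3 l1 l2 l3 : Cinf M} :
  (forall p, wedge3 f g (lie g f) p != 0) ->
  structure_functions f g k1 k2 k3 l1 l2 l3 ->
  f l1 + k3 * g l1 + (k2 + g k3) * l1 = 0.
Proof.
move=> w S; have Efh := lie_drift_bracket S; have [_ Egh] := S.
have := lie_jacobi f g.
rewrite Efh Egh !lieDr !lieZr !liexx (lie_antisym g f) Efh Egh.
rewrite !(lie_derN, lie_derD, lie_der_leibniz).
set h := lie g f => J.
(* [B] and [C] are the components along [g] and [h] of the difference of the two sides of the Jacobi
   identity. *)
pose B := f l2 - l3 * (k1 + k3 * l2) + g k1 + (k2 + g k3) * l2
  + k3 * (g l2 + l3 * l2).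
pose C := - l2 + f l3 - l3 * (k2 + k3 * l3) + g k2 + (k2 + g k3) * l3
  + k3 * (l1 + g l3 + l3 * l3).
suff /(frame_free w)[-> //] :
  (f l1 + k3 * g l1 + (k2 + g k3) * l1) *: f + B *: g + C *: h =
  0 *: f + 0 *: g + 0 *: h.
rewrite !scale0r !addr0; move/eqP: J; rewrite -subr_eq0 => /eqP <-.
by rewrite /B /C; vf_ring.
Qed.

(** With [fc = f + a *: g] and [gc = b *: g], the coefficient of [g] is [gc a - fc b]; it is the [s]
    of the next two expansions. *)
Lemma lie_feedback f g a b :
  lie (b *: g) (f + a *: g) = b *: lie g f + (b * g a - f b - a * g b) *: g.
Proof. by rewrite lieDr lieZr !lieZl liexx; vf_ring. Qed.

Lemma lie_gc_gc_fc {f g} {k1 k2 k3 l1 l2 l3 : Cinf M} {a b}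
    (s := b * g a - f b - a * g b) :
  structure_functions f g k1 k2 k3 l1 l2 l3 ->
  lie (b *: g) (lie (b *: g) (f + a *: g)) = (b * b * l1) *: f
    + (b * b * l2 - b * lie g f b + b * g s - s * g b) *: g
    + (b * (g b + b * l3)) *: lie g f.
Proof.
move=> [_ Egh]; rewrite lie_feedback -/s lieDr !lieZr !lieZl Egh liexx.
by vf_ring.
Qed.

Lemma lie_fc_fc_gc {f g} {k1 k2 k3 l1 l2 l3 : Cinf M} {a b}
    (s := b * g a - f b - a * g b) :
  structure_functions f g k1 k2 k3 l1 l2 l3 ->
  lie (f + a *: g) (lie (f + a *: g) (b *: g)) = (b * (k3 - a) * l1) *: f
    + (s * g a - f s - a * g s + b * lie g f a
       + b * (k1 + (k3 - a) * l2)) *: g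
    + (s - f b - a * g b + b * (k2 + (k3 - a) * l3)) *: lie g f.
Proof.
move=> S; have Efh := lie_drift_bracket S; have [_ Egh] := S.
have -> : lie (f + a *: g) (b *: g) = (- b) *: lie g f + (- s) *: g.
  by rewrite lie_antisym lie_feedback; vf_ring.
rewrite lieDr !lieZr !lieDl !lieZl Efh Egh liexx (lie_antisym g f).
by rewrite !lie_derN; vf_ring.
Qed.

End frame.

(** * The chain rule for the exponential *)

Lemma smooth_pseries {R : realType} {n : nat} {M : manifold R n} (a : Cinf M)
    (c : R^nat) :
  exp_dominated c -> exists b : Cinf M, forall p, b p = limn (pseries c (a p)).
Proof.
pose S := [set phi : R -> R | exists2 c, exp_dominated c &
  phi = fun t => limn (pseries c t)].
move=> cb; apply: (@smooth_comp _ _ _ S setT a (fun t => limn (pseries c t))) => //;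
  last by exists c.
move=> _ [d db ->]; exists (fun t => limn (pseries (pseries_diffs d) t)).
  by exists (pseries_diffs d) => //; exact: exp_dominated_diffs.
by move=> t _; exact: exp_dominated_derive.
Qed.

Lemma lim_pseries0 {R : realType} (c : R^nat) : limn (pseries c 0) = c 0%N.
Proof.
apply: cvg_lim => //; rewrite -cvg_shiftS.
rewrite [X in X @ _](_ : _ = cst (c 0%N)); first exact: cvg_cst.
apply/funext => n; rewrite /pseries /series /= big_nat_recl//= expr0 mulr1.
by rewrite big1 ?addr0// => i _; rewrite expr0n mulr0.
Qed.

Lemma lie_der_expR {R : realType} {n : nat} {M : manifold R n} (X : vfield M)
    (a b : Cinf M) :
  (forall p, a p = expR (b p)) -> X a = a * X b.
Proof.
move=> ab; apply: cinfP => p; rewrite cinfE ab.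
(* Subtracting the constant [b p] makes [v] vanish at [p] and preserves the derivative along [X]. *)
have [v vE Xv] : exists2 v : Cinf M, forall q, v q = b q - b p & X v = X b.
  exists (b - b p *: (1 : Cinf M)); first by move=> q; rewrite !cinfE mulr1.
  by rewrite lie_derB lie_derZ lie_der1 scaler0 subr0.
have [s sE] := smooth_pseries v _ exp_dominated_inv_factS.
have -> : a = expR (b p) *: ((1 : Cinf M) + v * s).
  apply: cinfP => q; rewrite !cinfE sE -expR_hadamard vE ab.
  by rewrite -expRD addrC subrK.
(* At [p] the term with [X s] carries the factor [v p = 0], and the other one has [s p = 1]. *)
rewrite lie_derZ lie_derD lie_der_leibniz lie_der1.
rewrite Xv !cinfE sE vE subrr lim_pseries0 factS fact0 muln1 invr1; ring.
Qed.

(** * The sign of [l1] and the normalising factor *)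

(** If [l1] vanished at [p], then [[g, [g, f]]] would be a combination of [g] and [[g, f]] there. *)
Lemma structure_l1_neq0 {R : realType} {n : nat} {M : manifold R n}
    {f g : vfield M} {k1 k2 k3 l1 l2 l3 : Cinf M} {p} :
  wedge3 g (lie g f) (lie g (lie g f)) p != 0 ->
  structure_functions f g k1 k2 k3 l1 l2 l3 -> l1 p != 0.
Proof.
move=> w [_ Egh]; apply/eqP => l10.
have [|_ _] := wedge3_free (x := - l2 p) (y := - l3 p) (z := 1) w.
  by move=> t; rewrite Egh !(vfD, vfZ, cinfE) l10; ring.
by move/eqP; rewrite oner_eq0.
Qed.

(* All three are built from powers and the logarithm of a ^ 2 > 0, which avoids a
   case distinction on the sign of a. *)
Lemma smooth_sg_powR_ln {R : realType} {n : nat} {M : manifold R n} (a : Cinf M) :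
  (forall p, a p != 0) -> exists e r L : Cinf M,
  [/\ forall p, e p = Num.sg (a p), forall p, r p = `|a p| `^ (- 2^-1)
    & forall p, L p = ln `|a p|].
Proof.
move=> a0; have sq p : (a * a) p = `|a p| `^ 2.
  by rewrite cinfE (powR_mulrn 2)// real_normK ?num_real// expr2.
have sq0 p : 0 < (a * a) p by rewrite sq powR_gt0 ?normr_gt0.
(* This [e] is [1 / |a|], so that [a * e] is the sign; exponents are halved because the base is
   [a ^ 2]. *)
have [e eE] := smooth_powR (a * a) (- 2^-1) sq0.
have [r rE] := smooth_powR (a * a) (- 4^-1) sq0.
have [L LE] := smooth_ln (a * a) sq0.
exists (a * e), r, (2^-1 *: L); split=> p.
- rewrite cinfE eE sq -powRrM (_ : 2 * - 2^-1 = -1); last by field.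
  by rewrite powR_inv1// {1}[a p]numEsg -mulrA divff ?normr_eq0// mulr1.
- by rewrite rE sq -powRrM; congr (_ `^ _); field.
- by rewrite cinfE LE sq ln_powR; field.
Qed.

Lemma unit_sign_sqr {R : realType} {n : nat} {M : manifold R n} (s : Cinf M) :
  (forall p, s p * s p = 1) -> unit_sign s.
Proof.
move=> ss p; have /eqP : (s p - 1) * (s p + 1) = 0.
  by rewrite mulrDr mulr1 mulrBl mul1r ss; ring.
rewrite mulf_eq0 subr_eq0 addr_eq0 => /orP[]/eqP; [by left|by right].
Qed.

Lemma sg_scale {R : realType} (x r : R) : x != 0 -> r = `|x| `^ (- 2^-1) ->
  r * r * x = Num.sg x.
Proof.
move=> x0 ->; rewrite -expr2 -(powR_mulrn 2) ?powR_ge0// -powRrM.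
rewrite (_ : - 2^-1 * 2 = -1); last by field.
by rewrite powR_inv1// [X in _ * X]numEsg mulrCA mulVf ?normr_eq0// mulr1.
Qed.

(** Both [e * a = exp L] and [r = exp (- L / 2)] are exponentials, and [e] is annihilated by [X]. *)
Lemma canonical_scale_derivations {R : realType} {n : nat} {M : manifold R n}
    (X : vfield M) (a e r L : Cinf M) :
  (forall p, a p != 0) ->
  (forall p, e p = Num.sg (a p)) -> (forall p, r p = `|a p| `^ (- 2^-1)) ->
  (forall p, L p = ln `|a p|) ->
  [/\ X a = a * X L, X e = 0 & X r = (- 2^-1) *: (r * X L)].
Proof.
move=> a0 eE rE LE.
have us : unit_sign e.
  by apply: unit_sign_sqr => p; rewrite eE -expr2 sqr_sg a0.
have Xe : X e = 0 by exact: lie_der_unit_sign.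
split=> //.
- have : X (e * a) = e * a * X L.
    apply: lie_der_expR => p.
    by rewrite cinfE eE LE lnK ?posrE ?normr_gt0// -normrEsg.
  rewrite lie_der_leibniz Xe mul0r add0r => H; apply: cinfP => p.
  have := congr1 (fun c : Cinf M => c p) H; rewrite !cinfE -mulrA.
  by apply: mulfI; case: (us p) => ->; rewrite ?oner_eq0// oppr_eq0 oner_eq0.
- rewrite -[X in X = _]scale1r.
  have -> : X r = r * X ((- 2^-1) *: L).
    apply: lie_der_expR => p; rewrite cinfE rE LE /powR.
    by rewrite gt_eqF ?normr_gt0.
  by apply: cinfP => p; rewrite lie_derZ !cinfE; ring.
Qed.

Lemma lieZ_const {R : realType} {n : nat} {M : manifold R n} (X Y : vfield M)
    (s : Cinf M) : X s = 0 -> lie X (s *: Y) = s *: lie X Y.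
Proof. by move=> Xs; rewrite lieZr Xs scale0r add0r. Qed.

(** * The canonical pair, its invariants and their uniqueness up to sign *)

(** Sign, power and logarithm must be elements of [Cinf M], hence the existential quantifiers. The
    sign [s] is a function because it may differ between components of [M]. *)
Theorem proposition4 (R : realType) (M : manifold R 3) (f g : vfield M)
    (k1 k2 k3 l1 l2 l3 : Cinf M) :
  (forall p : M, wedge3 f g (lie g f) p != 0) ->
  (forall p : M, wedge3 g (lie g f) (lie g (lie g f)) p != 0) ->
  structure_functions f g k1 k2 k3 l1 l2 l3 ->
  exists sgn_l1 rsqrt_l1 ln_l1 : Cinf M,
    [/\ forall p, sgn_l1 p = Num.sg (l1 p),
        forall p, rsqrt_l1 p = `|l1 p| `^ (- 2^-1),
        forall p, ln_l1 p = ln `|l1 p| &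
        let kappa := k1 + 2^-1 *: f (k2 - g k3) + 4^-1 *: (k2 - g k3) ^+ 2
                     + lie g f k3 + 2^-1 *: (k3 * g (k2 - g k3)) in
        let nu := rsqrt_l1 * (l3 - 2^-1 *: g ln_l1) in
        let fc := f + k3 *: g in
        let gc := rsqrt_l1 *: g in
        invariants f g fc gc sgn_l1 kappa nu /\
        (forall (fc' gc' : vfield M) (e' kappa' nu' : Cinf M),
           invariants f g fc' gc' e' kappa' nu' ->
           exists s : Cinf M,
             [/\ unit_sign s, fc' = fc & gc' = s *: gc] /\
             [/\ e' = sgn_l1, kappa' = kappa & nu' = s * nu])].
Proof.
move=> w1 w2 S.
have l1n0 p : l1 p != 0 by exact: structure_l1_neq0 (w2 p) S.
have [e [r [L [eE rE LE]]]] := smooth_sg_powR_ln l1 l1n0.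
exists e, r, L; split=> // kappa nu fc gc.
have der X := canonical_scale_derivations X l1 e r L l1n0 eE rE LE.
have [fl1 _ fr] := der f; have [gl1 _ gr] := der g.
have ue : unit_sign e.
  by apply: unit_sign_sqr => p; rewrite eE -expr2 sqr_sg l1n0.
have rrl1 : r * r * l1 = e.
  by apply: cinfP => p; rewrite !cinfE eE (sg_scale (l1 p)).
have r0 p : r p != 0 by rewrite rE gt_eqF ?powR_gt0 ?normr_gt0.
pose w := 2^-1 *: (k2 - g k3).
(* This is the Jacobi relation divided by [l1]: the derivative of [ln |l1|] along [fc]. *)
have fcL : f L + k3 * g L = - (k2 + g k3).
  have := structure_jacobi w1 S; rewrite fl1 gl1 => J.
  apply: cinfP => p; have := congr1 (fun c : Cinf M => c p) J.
  rewrite !cinfE => Jp; apply/eqP; rewrite -subr_eq0 -(mulrI_eq0 _ (mulfI (l1n0 p))).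
  by apply/eqP; rewrite -[RHS]Jp; ring.
have fcL' : f L = - (k2 + g k3) - k3 * g L by rewrite -fcL addrK.
(* Hence [[gc, fc] = r [g, f] - r w g]. *)
have sE : r * g k3 - f r - k3 * g r = - (r * w).
  rewrite fr gr fcL' /w; apply: cinfP => p.
  by rewrite !cinfE; field.
have nuE : nu = g r + r * l3.
  by rewrite gr /nu; apply: cinfP => p; rewrite !cinfE; ring.
have Ekappa : lie fc (lie fc gc) = kappa *: gc.
  rewrite (lie_fc_fc_gc S) sE !lie_derN !lie_der_leibniz.
  rewrite fr gr fcL' /kappa /gc /w !lie_derZ expr2.
  apply: vfieldP => t; apply: cinfP => p; rewrite !(vfD, vfN, vfZ, cinfE).
  by field.
have Enu : exists mu, lie gc (lie gc fc) = e *: fc + mu *: gc + nu *: lie gc fc.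
  (* The witness is the component along [g] divided by [r], with [e] written as [r * r * l1]. *)
  exists (r * l2 - lie g f r - g (r * w) + w * g r - r * l1 * k3 + nu * w).
  rewrite (lie_gc_gc_fc S) lie_feedback sE lie_derN -rrl1.
  rewrite nuE /fc /gc; vf_ring.
split.
  split=> //.
  - by exists k3, r.
  - have [mu Emu] := Enu; exists kappa, 0, 0, e, mu, nu; split=> //; split=> //.
    by rewrite Ekappa !scale0r !addr0.
move=> fc' gc' e' kappa' nu' [[a [b [b0 -> ->]]] _ Ekappa' ue' [mu' Enu']].
have kgE : kappa' *: (b *: g) = 0 *: f + (kappa' * b) *: g + 0 *: lie g f.
  by vf_ring.
have := Ekappa'; rewrite (lie_fc_fc_gc S) kgE.
case/(frame_free w1) => ka _ _.
have {ka} ak : a = k3.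
  apply: cinfP => p; have /eqP := congr1 (fun c : Cinf M => c p) ka.
  rewrite !cinfE !mulf_eq0 (negPf (b0 p)) (negPf (l1n0 p)) orbF /=.
  by rewrite subr_eq0 => /eqP.
rewrite {}ak {a} in Ekappa' Enu' *.
have nuE' : e' *: (f + k3 *: g) + mu' *: (b *: g)
    + nu' *: lie (b *: g) (f + k3 *: g) = e' *: f
    + (e' * k3 + mu' * b + nu' * (b * g k3 - f b - k3 * g b)) *: g
    + (nu' * b) *: lie g f.
  by rewrite lie_feedback; vf_ring.
have := Enu'; rewrite (lie_gc_gc_fc S) nuE'.
case/(frame_free w1) => bbl1 _ nub.
(* Both [b^2 l1] and [r^2 l1] are 1 or -1 with the sign of [l1], so the positive factors agree. *)
have bbrr p : b p * b p = r p * r p.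
  have := ue' p; have := ue p; rewrite -bbl1 -rrl1 !cinfE.
  move=> H1 H2; apply: (mulIf (l1n0 p)).
  have : 0 < b p * b p by rewrite -expr2 exprn_even_gt0//= b0.
  have : 0 < r p * r p by rewrite -expr2 exprn_even_gt0//= r0.
  by case: H1 H2 => H1 [] H2; nra.
have ee : e' = e by rewrite -bbl1 -rrl1; apply: cinfP => p; rewrite !cinfE bbrr.
have e2 : e * e = 1.
  by apply: cinfP => p; rewrite !cinfE; case: (ue p) => ->; ring.
have [s sr] : exists s, s * r = b.
  (* The quotient [b / r]: since [r * r * l1 * e = 1], the inverse of [r] is [r * l1 * e]. *)
  exists (b * r * l1 * e).
  have -> : b * r * l1 * e * r = b * (r * r * l1 * e) by ring.
  by rewrite rrl1 e2 mulr1.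
have us : unit_sign s.
  apply: unit_sign_sqr => p; apply: (mulIf (r0 p)); apply: (mulIf (r0 p)).
  have sp := congr1 (fun c : Cinf M => c p) sr; rewrite cinfE in sp.
  by rewrite mul1r -bbrr -sp; ring.
have gs : g s = 0 by exact: lie_der_unit_sign.
have fs : fc s = 0 by exact: lie_der_unit_sign.
exists s; split; first by split=> //; rewrite /gc -sr; vf_ring.
split=> //.
  have bE : b *: g = s *: gc by rewrite /gc -sr; vf_ring.
  move: Ekappa'; rewrite -/fc bE.
  (* As [fc s = 0], the factor [s] leaves both brackets, so [kappa] is insensitive to it. *)
  rewrite !(lieZ_const fc gc, lieZ_const fc (lie fc gc)) // Ekappa => K.
  have /(frame_free w1)[_ kk _] :
      0 *: f + (kappa * b) *: g + 0 *: lie g f =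
      0 *: f + (kappa' * b) *: g + 0 *: lie g f.
    by rewrite -[(kappa * b) *: g]scalerA -[(kappa' * b) *: g]scalerA bE -K
       !scalerA (mulrC s kappa).
  apply: cinfP => p; have := congr1 (fun c : Cinf M => c p) kk.
  by rewrite !cinfE => /(mulIf (b0 p)).
(* The component along [[g, f]] gives [nu' = g b + b l3]; put [b = s r] with [g s = 0]. *)
apply: cinfP => p; have := congr1 (fun c : Cinf M => c p) nub.
rewrite nuE -sr lie_der_leibniz gs mul0r add0r !cinfE => H.
have bp : s p * r p != 0 by have := b0 p; rewrite -sr cinfE.
by apply: (mulIf bp); rewrite -H; ring.
Qed.
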